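(* Let $E:=[a,b]\subset\mathbb R$ with $a<b$, let $f\in C^{(2)}(E)$ be a convex function with $M_f(E)>0$, let $\mathbf x=(x_1,\dots,x_n)$ with all $x_i\in E$, and let $\mathbf p=(p_1,\dots,p_n)$ with $p_i>0$ and $\sum_{i=1}^n p_i=1$. Write $m=m_f(E)$ and $M=M_f(E)$. Then $$\frac{m}{m+M}\Bigl[f(a)+f(b)-2f\Bigl(\frac{a+b}{2}\Bigr)\Bigr]+\frac{mM}{m+M}\Bigl(J_n(\mathbf p,\mathbf x;x^2)-\frac14(b-a)^2\Bigr)\le J_n(\mathbf p,\mathbf x;f)$$ and $$J_n(\mathbf p,\mathbf x;f)\le \frac{M}{m+M}\Bigl[f(a)+f(b)-2f\Bigl(\frac{a+b}{2}\Bigr)\Bigr]+\frac{mM}{m+M}\Bigl(J_n(\mathbf p,\mathbf x;x^2)-\frac14(b-a)^2\Bigr).$$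
   Context: $J_n(\mathbf p,\mathbf x;f):=\sum_{i=1}^n p_i f(x_i)-f\bigl(\sum_{i=1}^n p_i x_i\bigr)$ is the Jensen functional; in particular $J_n(\mathbf p,\mathbf x;x^2)=\sum_{i=1}^n p_i x_i^2-\bigl(\sum_{i=1}^n p_i x_i\bigr)^2$. Also $m_f(E):=\min_{t\in E}f''(t)$ and $M_f(E):=\max_{t\in E}f''(t)$. *)

(* Defs.v *)
From HB Require Import structures.
From mathcomp Require Import all_boot all_order all_algebra.
From mathcomp Require Import boolp classical_sets set_interval reals.
From mathcomp Require Import topology normedtype convex.

Set Implicit Arguments.
Unset Strict Implicit.
Unset Printing Implicit Defensive.

Import Order.TTheory GRing.Theory Num.Theory.
Import numFieldNormedType.Exports.

Local Open Scope classical_set_scope.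
Local Open Scope ring_scope.

Definition jensen (R : realType) (n : nat) (p x : 'I_n -> R) (f : R -> R) : R :=
  \sum_(i < n) p i * f (x i) - f (\sum_(i < n) p i * x i).

(* Derivatives are taken relative to a set E, so that at an endpoint of an
   interval they are one-sided and the values of f outside E play no role; the
   library's [derivable] and [derive1] would look at both sides. *)
Definition diff_quotient (R : realType) (f : R -> R) (x y : R) : R :=
  (f y - f x) / (y - x).

Definition derivable_within (R : realType) (E : set R) (f : R -> R) : Prop :=
  forall x, E x -> cvg (diff_quotient f x y @[y --> within E x^']).

Definition derive_within (R : realType) (E : set R) (f : R -> R) : R -> R :=
  fun x => lim (diff_quotient f x y @[y --> within E x^']).

Definition derive2_within (R : realType) (E : set R) (f : R -> R) : R -> R :=
  derive_within E (derive_within E f).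

Definition C2_within (R : realType) (E : set R) (f : R -> R) : Prop :=
  [/\ derivable_within E f,
      derivable_within E (derive_within E f) &
      {within E, continuous (derive2_within E f)}].

(* Meaningful only when A has a least, resp. greatest, element; this is the
   case when A is the image of `[a, b] by a continuous function. *)
Definition set_min (R : realType) (A : set R) : R :=
  get [set m | A m /\ lbound A m].

Definition set_max (R : realType) (A : set R) : R :=
  get [set m | A m /\ ubound A m].

Definition min_derive2 (R : realType) (E : set R) (f : R -> R) : R :=
  set_min (derive2_within E f @` E).

Definition max_derive2 (R : realType) (E : set R) (f : R -> R) : R :=
  set_max (derive2_within E f @` E).

(* Main.v *)
Require Import Defs.
From HB Require Import structures.
From mathcomp Require Import all_boot all_order all_algebra.
From mathcomp Require Import boolp classical_sets set_interval reals.
From mathcomp Require Import topology normedtype convex.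
From mathcomp Require Import interval_inference derive ring lra.

Set Implicit Arguments.
Unset Strict Implicit.
Unset Printing Implicit Defensive.

Import Order.TTheory GRing.Theory Num.Theory.
Import numFieldNormedType.Exports.

Local Open Scope classical_set_scope.
Local Open Scope ring_scope.

(** If a function g on [a, b] lies above all its tangents, then
      0 <= J(g) <= T(g)  where  T(g) = g a + g b - 2 g ((a + b) / 2).
    The left inequality ([jensen_ge0]) is the tangent at the barycenter,
    averaged with the weights.  For the right one ([jensen_le]) let y be the
    reflection of the barycenter xbar in the midpoint of [a, b].  The mean of
    the g (x i) is at most the chord of g at xbar; chord (xbar) + chord (y) is
    g a + g b; and chord (y) + g xbar >= g y + g xbar >= 2 g ((a + b) / 2).

    Since m <= f'' <= M, both g = f - (m / 2) t^2 and h = (M / 2) t^2 - f have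
    a nonnegative second derivative, hence lie above their tangents
    ([above_tangents_comb_sqr]).  J and T are linear, and
    T(t^2) = (b - a)^2 / 2, so the four bounds on J(g) and J(h) bracket J(f)
    in terms of J(t^2) and T(f).  Because m >= 0 ([convex_derivative2_ge0])
    and M > 0, these bounds can be weighted:
      upper bound:  M (J(g) <= T(g))  plus  m (0 <= J(h)),
      lower bound:  M (0 <= J(g))     plus  m (J(h) <= T(h)),
    and division by m + M gives the theorem.

    The derivatives are one-sided at a and b, so the mean value theorem on a
    subsegment of [a, b] is first recovered for them: inside the segment they
    are ordinary derivatives, and they force continuity up to the endpoints. *)

(** * Derivatives relative to a set *)

(** A relation between f and d, rather than a limit of f: the derivative of a
    linear combination then follows without uniqueness of limits, which fails
    at isolated points of E. *)
Definition has_derivative_within (R : realType) (E : set R) (f d : R -> R) :=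
  forall x, E x -> diff_quotient f x y @[y --> within E x^'] --> d x.

Section HasDerivativeWithin.
Context {R : realType} (E : set R).
Implicit Types (f g d e : R -> R) (x y : R).

Lemma derivable_within_derivative f :
  derivable_within E f -> has_derivative_within E f (derive_within E f).
Proof. by move=> df x Ex; exact: df. Qed.

Lemma has_derivative_within_dist f d x : has_derivative_within E f d -> E x ->
  forall eps, 0 < eps -> exists2 delta, 0 < delta &
    forall y, E y -> y != x -> `|x - y| < delta ->
      `|d x - diff_quotient f x y| < eps.
Proof.
move=> fd Ex eps eps0; have /cvgrPdist_lt /(_ _ eps0) := fd _ Ex.
by case=> delta /= delta0 H; exists delta => // y Ey yx xy; exact: H.
Qed.

Lemma has_derivative_within_comb (c k : R) f g d e :
  has_derivative_within E f d -> has_derivative_within E g e ->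
  has_derivative_within E (fun x => c * f x + k * g x)
    (fun x => c * d x + k * e x).
Proof.
move=> fd ge x Ex.
have -> : diff_quotient (fun x => c * f x + k * g x) x =
    (fun y => c * diff_quotient f x y + k * diff_quotient g x y).
  by apply/funext => y; rewrite /diff_quotient; ring.
by apply: cvgD; (apply: cvgM; first exact: cvg_cst); [exact: fd|exact: ge].
Qed.

Lemma has_derivative_within_id : has_derivative_within E id (fun=> 1).
Proof.
move=> x Ex; apply/cvgrPdist_lt => eps eps0.
exists 1 => //= y _ yx _.
by rewrite /diff_quotient divff ?subr_eq0// subrr normr0.
Qed.

Lemma has_derivative_within_sqr :
  has_derivative_within E (fun x => x ^+ 2) (fun x => 2 * x).
Proof.
move=> x Ex; apply/cvgrPdist_lt => eps eps0.
exists eps => //= y xy yx _.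
have -> : diff_quotient (fun x => x ^+ 2) x y = x + y.
  by rewrite /diff_quotient; field; rewrite subr_eq0.
by have -> : 2 * x - (x + y) = x - y by ring.
Qed.

End HasDerivativeWithin.

(** * Calculus on a segment *)

Section Segment.
Context {R : realType} (a b : R).
Implicit Types (f g d e : R -> R) (u v : R).
Local Notation E := (`[a, b]%classic : set R).

Lemma segment_convex u v t : E u -> E v -> 0 <= t -> t <= 1 ->
  E (u + t * (v - u)).
Proof.
rewrite /= !in_itv /= => /andP[au ub] /andP[av vb] t0 t1.
apply/andP; split; nra.
Qed.

Lemma segment_point_neq u v t : u != v -> 0 < t -> u + t * (v - u) != u.
Proof.
move=> uv t0; rewrite -subr_eq0 addrAC subrr add0r mulf_eq0 gt_eqF//=.
by rewrite subr_eq0 eq_sym.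
Qed.

(** Differentiability used along the ray from u to v only: this treats u < v
    and v < u alike, and keeps the difference quotient on the side of u where
    convexity compares it with the slope of the chord from u to v. *)
Lemma derivative_within_radial f d u v eps : has_derivative_within E f d ->
  E u -> E v -> u != v -> 0 < eps -> exists t, [/\ 0 < t, t < 1 &
    `|d u - diff_quotient f u (u + t * (v - u))| < eps].
Proof.
move=> fd Eu Ev uv eps0.
have [delta delta0 H] := has_derivative_within_dist fd Eu eps0.
have n0 : 0 < `|v - u| by rewrite normr_gt0 subr_eq0 eq_sym.
pose s := delta / (`|v - u| * 2).
have s0 : 0 < s by rewrite divr_gt0// mulr_gt0.
pose t := Num.min s (1 / 2).
have t0 : 0 < t by rewrite lt_min s0 divr_gt0.
have t1 : t < 1 by rewrite gt_min; apply/orP; right; lra.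
exists t; split => //; apply: H.
- by apply: segment_convex => //; exact: ltW.
- exact: segment_point_neq.
- rewrite opprD addrA subrr add0r normrN normrM gtr0_norm//.
  rewrite (@le_lt_trans _ _ (s * `|v - u|))//.
    by rewrite ler_wpM2r// ge_min lexx.
  have -> : s * `|v - u| = delta / 2 by rewrite /s; field; rewrite gt_eqF.
  lra.
Qed.

Lemma has_derivative_within_continuous f d : has_derivative_within E f d ->
  {within E, continuous f}.
Proof.
move=> fd; apply/subspace_continuousP => x Ex.
apply/cvgrPdist_lt => eps eps0.
have [delta delta0 H] := has_derivative_within_dist fd Ex ltr01.
(* Near x the difference quotients are bounded by `|d x| + 1, so f is
   Lipschitz at x with this constant. *)
have K0 : 0 < `|d x| + 1 by rewrite ltr_wpDl.
exists (Num.min delta (eps / (`|d x| + 1))).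
  by rewrite /= lt_min delta0 divr_gt0.
move=> y /= xy Ey.
have [->|yx] := eqVneq y x; first by rewrite subrr normr0.
move: xy; rewrite lt_min => /andP[xy1 xy2].
have q1 : `|diff_quotient f x y| < `|d x| + 1.
  have := H y Ey yx xy1; have := ler_normB (d x) (d x - diff_quotient f x y).
  have -> : d x - (d x - diff_quotient f x y) = diff_quotient f x y by ring.
  lra.
have -> : f x - f y = diff_quotient f x y * (x - y).
  by rewrite /diff_quotient; field; rewrite subr_eq0.
rewrite normrM; have xy0 : 0 < `|x - y| by rewrite normr_gt0 subr_eq0 eq_sym.
rewrite (@lt_trans _ _ ((`|d x| + 1) * `|x - y|))// ?ltr_pM2r//.
by rewrite mulrC -ltr_pdivlMr.
Qed.

Lemma has_derivative_within_is_derive f d x : has_derivative_within E f d ->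
  x \in `]a, b[ -> is_derive x 1 f (d x).
Proof.
move=> fd; rewrite in_itv/= => /andP[ax xb].
have Ex : E x by rewrite /= in_itv/= !ltW.
have H : (fun h => h^-1 *: ((f \o shift x) (h *: (1 : R)) - f x)) @ (0 : R)^'
    --> d x.
  apply/cvgrPdist_lt => eps eps0.
  have [delta delta0 H] := has_derivative_within_dist fd Ex eps0.
  (* The last two bounds keep h + x inside the segment. *)
  exists (Num.min delta (Num.min (x - a) (b - x))).
    by rewrite /= !lt_min delta0 !subr_gt0 ax xb.
  move=> h /=; rewrite sub0r normrN !lt_min => /and3P[hd ha hb] h0.
  have /andP[ha1 _] : - (x - a) < h < x - a by rewrite -ltr_norml.
  have /andP[_ hb2] : - (b - x) < h < b - x by rewrite -ltr_norml.
  have := H (h + x); rewrite /diff_quotient addrK.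
  rewrite [h^-1 *: _]mulrC [h *: _]mulr1; apply.
  - by rewrite /= in_itv/=; apply/andP; split; lra.
  - by rewrite -subr_eq0 addrK.
  - by rewrite (_ : x - (h + x) = - h) ?normrN//; ring.
apply: DeriveDef; first by apply/cvg_ex; exists (d x).
exact/cvg_lim.
Qed.

Lemma mean_value_within f d u v : has_derivative_within E f d ->
  E u -> E v -> u < v ->
  exists c, [/\ u < c, c < v & f v - f u = d c * (v - u)].
Proof.
move=> fd Eu Ev uv.
have auvb : a <= u /\ v <= b.
  by move: Eu Ev; rewrite /= !in_itv/= => /andP[? ?] /andP[].
have sub : `[u, v]%classic `<=` E.
  by move=> y; rewrite /= !in_itv/= => /andP[? ?]; apply/andP; split; lra.
have der y : y \in `]u, v[ -> is_derive y 1 f (d y).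
  move=> yuv; apply: has_derivative_within_is_derive fd _.
  by move: yuv; rewrite !in_itv/= => /andP[? ?]; apply/andP; split; lra.
have cont := continuous_subspaceW sub (has_derivative_within_continuous fd).
have [c + ->] := MVT uv der cont.
by rewrite in_itv/= => /andP[uc cv]; exists c.
Qed.

(** The form of convexity from which all bounds on the Jensen functional are
    derived; the slope d is explicit because it comes from differentiation. *)
Definition above_tangents f d :=
  forall u v, E u -> E v -> f u + d u * (v - u) <= f v.

Lemma derivative_nondecreasing f d u v : has_derivative_within E f d ->
  (forall x, E x -> 0 <= d x) -> E u -> E v -> u <= v -> f u <= f v.
Proof.
move=> fd d0 Eu Ev; rewrite le_eqVlt => /predU1P[->//|uv].
have [c [uc cv fuv]] := mean_value_within fd Eu Ev uv.
rewrite -subr_ge0 fuv mulr_ge0 ?subr_ge0 ?(ltW uv)//; apply: d0.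
move: Eu Ev; rewrite /= !in_itv/= => /andP[? ?] /andP[? ?].
by apply/andP; split; lra.
Qed.

(** The difference f v - f u is d c * (v - u) for some c between u and v, and
    d is nondecreasing. *)
Lemma above_tangents_derivative2_ge0 f d e : has_derivative_within E f d ->
  has_derivative_within E d e -> (forall x, E x -> 0 <= e x) ->
  above_tangents f d.
Proof.
move=> fd de e0 u v Eu Ev.
have dmono x y : E x -> E y -> x <= y -> d x <= d y.
  exact: derivative_nondecreasing de e0.
have Ebetween x y c : E x -> E y -> x < c -> c < y -> E c.
  rewrite /= !in_itv/= => /andP[? ?] /andP[? ?] ? ?.
  by apply/andP; split; lra.
case: (ltgtP u v) => [uv|vu|->]; last by rewrite subrr mulr0 addr0.
- have [c [uc cv fuv]] := mean_value_within fd Eu Ev uv.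
  have : d u <= d c by apply: dmono => //; [exact: Ebetween uc cv|exact: ltW].
  by move=> ?; nra.
- have [c [vc cu fvu]] := mean_value_within fd Ev Eu vu.
  have : d c <= d u by apply: dmono => //; [exact: Ebetween vc cu|exact: ltW].
  by move=> ?; nra.
Qed.

(** By convexity no difference quotient taken towards v exceeds the slope of
    the chord from u to v (or, if v < u, falls below it); the limit d u inherits
    this. *)
Lemma convex_above_tangents f d : has_derivative_within E f d ->
  convex_function E f -> above_tangents f d.
Proof.
move=> fd cf u v Eu Ev.
have [->|uv] := eqVneq u v; first by rewrite subrr mulr0 addr0.
rewrite leNgt; apply/negP => H.
(* The gap between d u and the slope of the chord. *)
pose eps := (f u + d u * (v - u) - f v) / `|v - u|.
have n0 : 0 < `|v - u| by rewrite normr_gt0 subr_eq0 eq_sym.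
have eps0 : 0 < eps by rewrite divr_gt0// subr_gt0.
have [t [t0 t1]] := derivative_within_radial fd Eu Ev uv eps0.
rewrite ltr_pdivlMr// -normrM.
set q := diff_quotient _ _ _.
have qE : q * (v - u) = (f (u + t * (v - u)) - f u) / t.
  rewrite /q /diff_quotient; field.
  by rewrite subr_eq0 segment_point_neq//= gt_eqF.
have ct : f (u + t * (v - u)) <= t * f v + (1 - t) * f u.
  rewrite (_ : u + t * (v - u) = t * v + (1 - t) * u); last by ring.
  by apply: (cf (Itv01 (ltW t0) (ltW t1)) v u); rewrite inE.
have qle : q * (v - u) <= f v - f u by rewrite qE ler_pdivrMr//; lra.
rewrite ltNge => /negP; apply; apply: le_trans (ler_norm _).
lra.
Qed.

(** Adding the tangent inequalities at two points shows that d is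
    nondecreasing, so its difference quotients are nonnegative.  The hypothesis
    a < b excludes a one-point segment, where every e is a derivative of d. *)
Lemma convex_derivative2_ge0 f d e : a < b -> has_derivative_within E f d ->
  has_derivative_within E d e -> convex_function E f ->
  forall x, E x -> 0 <= e x.
Proof.
move=> ab fd de cf x Ex; rewrite leNgt; apply/negP => ex0.
have tang := convex_above_tangents fd cf.
have [v Ev xv] : exists2 v, E v & x != v.
  have [->|xa] := eqVneq x a.
    by exists b; rewrite ?lt_eqF//= in_itv/= lexx ltW.
  by exists a => //; rewrite /= in_itv/= lexx ltW.
have ex0' : 0 < - e x by rewrite oppr_gt0.
have [t [t0 t1]] := derivative_within_radial de Ex Ev xv ex0'.
set y := x + _; set q := diff_quotient _ _ _ => eq.
have Ey : E y by apply: segment_convex => //; exact: ltW.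
have yx : y != x by exact: segment_point_neq.
have q0 : 0 <= q.
  have dxy : 0 <= (d y - d x) * (y - x).
    have := tang x y Ex Ey; have := tang y x Ey Ex; lra.
  have -> : q = (d y - d x) * (y - x) / (y - x) ^+ 2.
    by rewrite /q /diff_quotient; field; rewrite subr_eq0.
  by rewrite divr_ge0// sqr_ge0.
by move: eq; rewrite ltr_norml; lra.
Qed.

(** The chord lies above the graph as soon as the tangent at the intermediate
    point lies below it at both ends. *)
Lemma above_tangents_chord f d l : above_tangents f d -> E a -> E b ->
  0 <= l -> l <= 1 -> f (a + l * (b - a)) <= (1 - l) * f a + l * f b.
Proof.
move=> tang Ea Eb l0 l1; set w := a + _.
have Ew : E w by exact: segment_convex.
have := tang w a Ew Ea; have := tang w b Ew Eb.
set dw := d w => tb ta.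
(* The slope cancels because w is the barycenter of a and b. *)
have fw : f w = (1 - l) * (f w + dw * (a - w)) + l * (f w + dw * (b - w)).
  have w0 : (1 - l) * (a - w) + l * (b - w) = 0 by rewrite /w; ring.
  transitivity (f w + dw * ((1 - l) * (a - w) + l * (b - w))); last by ring.
  by rewrite w0 mulr0 addr0.
by rewrite fw lerD// ler_wpM2l// subr_ge0.
Qed.

(** Serves both corrections of f at once: c = 1, k = - (m / 2) and
    c = -1, k = M / 2. *)
Lemma above_tangents_comb_sqr f d e (c k : R) : has_derivative_within E f d ->
  has_derivative_within E d e -> (forall t, E t -> 0 <= c * e t + k * 2) ->
  above_tangents (fun t => c * f t + k * t ^+ 2)
    (fun t => c * d t + k * (2 * t)).
Proof.
move=> fd de H.
have H1 : has_derivative_within E (fun t => c * f t + k * t ^+ 2)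
    (fun t => c * d t + k * (2 * t)).
  exact: has_derivative_within_comb fd (@has_derivative_within_sqr _ E).
apply: above_tangents_derivative2_ge0 H1 _ H.
have := @has_derivative_within_comb _ _ c (k * 2) _ _ _ _ de
  (@has_derivative_within_id _ E).
rewrite (_ : (fun t => c * d t + k * 2 * id t) =
             (fun t => c * d t + k * (2 * t))); last first.
  by apply/funext => t; rewrite mulrA.
by rewrite (_ : (fun t => c * e t + k * 2 * 1) =
  (fun t => c * e t + k * 2))//; apply/funext => t; rewrite mulr1.
Qed.

(** * Bounds for the Jensen functional *)

Section Jensen.
Context (n : nat) (p x : 'I_n -> R).
Hypotheses (xE : forall i, E (x i)) (p0 : forall i, 0 <= p i)
  (p1 : \sum_(i < n) p i = 1).
Local Notation xbar := (\sum_(i < n) p i * x i).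

Lemma barycenter_in : E xbar.
Proof.
rewrite /= in_itv/= -[a]mul1r -[b]mul1r -p1 !mulr_suml.
by apply/andP; split; apply: ler_sum => i _; have := xE i;
  rewrite /= in_itv/= => /andP[? ?]; rewrite ler_wpM2l.
Qed.

Lemma mean_affine (c e : R) : \sum_(i < n) p i * (c + e * x i) = c + e * xbar.
Proof.
under eq_bigr do rewrite mulrDr mulrCA.
by rewrite big_split/= -mulr_suml -mulr_sumr p1 mul1r.
Qed.

Lemma jensen_ge0 f d : above_tangents f d -> 0 <= jensen p x f.
Proof.
move=> tang; rewrite /jensen subr_ge0.
have -> : f xbar = f xbar - d xbar * xbar + d xbar * xbar by ring.
rewrite -mean_affine; apply: ler_sum => i _; rewrite ler_wpM2l//.
have := tang _ _ barycenter_in (xE i); lra.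
Qed.

Lemma jensen_le f d : a < b -> above_tangents f d ->
  jensen p x f <= f a + f b - 2 * f ((a + b) / 2).
Proof.
move=> ab tang.
have Ea : E a by rewrite /= in_itv/= lexx ltW.
have Eb : E b by rewrite /= in_itv/= lexx ltW.
have ba0 : 0 < b - a by rewrite subr_gt0.
have ba : b - a != 0 by rewrite gt_eqF.
pose l y := (y - a) / (b - a).
have lE y : a + l y * (b - a) = y by rewrite /l; field.
have l01 y : E y -> 0 <= l y /\ l y <= 1.
  rewrite /= in_itv/= => /andP[? ?]; rewrite /l.
  by split; [rewrite divr_ge0// ?(ltW ba0)//|rewrite ler_pdivrMr//]; lra.
have chord y : E y -> f y <= (1 - l y) * f a + l y * f b.
  move=> Ey; have [l0 l1] := l01 y Ey.
  by have := above_tangents_chord tang Ea Eb l0 l1; rewrite lE.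
(* The reflection of the barycenter in the midpoint of the segment. *)
pose ybar := a + b - xbar.
have Ex := barycenter_in.
have Ey : E ybar.
  move: Ex; rewrite /ybar /= !in_itv/= => /andP[? ?].
  by apply/andP; split; lra.
have ly : l ybar = 1 - l xbar by rewrite /l /ybar; field.
have sumle : \sum_(i < n) p i * f (x i) <= (1 - l xbar) * f a + l xbar * f b.
  (* The chord is affine, so its weighted mean is its value at xbar. *)
  pose e := (f b - f a) / (b - a).
  have lineE y : (1 - l y) * f a + l y * f b = f a - e * a + e * y.
    by rewrite /e /l; field.
  rewrite lineE -mean_affine; apply: ler_sum => i _.
  by rewrite ler_wpM2l// -lineE chord.
(* The tangent at the midpoint, evaluated at xbar and ybar: the two linear terms
   cancel because xbar + ybar = a + b. *)
have Em : E ((a + b) / 2) by rewrite /= in_itv/=; apply/andP; split; lra.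
have := tang _ _ Em Ex; have := tang _ _ Em Ey; have := chord _ Ey.
rewrite ly /jensen; rewrite {2}/ybar; lra.
Qed.

Lemma jensen_comb c k f g :
  jensen p x (fun t => c * f t + k * g t) = c * jensen p x f + k * jensen p x g.
Proof.
rewrite /jensen !mulrBr !mulr_sumr.
under eq_bigr do rewrite mulrDr mulrCA (mulrCA _ k).
by rewrite big_split/=; ring.
Qed.

End Jensen.

(** * Extrema of the second derivative, and the inequalities *)

Lemma min_derive2P f : a <= b -> {within E, continuous (derive2_within E f)} ->
  (exists2 c, E c & derive2_within E f c = min_derive2 E f) /\
  forall t, E t -> min_derive2 E f <= derive2_within E f t.
Proof.
move=> ab cf; have [c cE cmin] := EVT_min ab cf.
have [[c' c'E c'min] lb] : [set m | (derive2_within E f @` E) m /\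
    lbound (derive2_within E f @` E) m] (min_derive2 E f).
  apply: getI (derive2_within E f c) _.
  by split; [exists c|move=> _ [t tE <-]; exact: cmin].
by split; [exists c'|move=> t tE; apply: lb; exists t].
Qed.

Lemma max_derive2P f : a <= b -> {within E, continuous (derive2_within E f)} ->
  forall t, E t -> derive2_within E f t <= max_derive2 E f.
Proof.
move=> ab cf; have [c cE cmax] := EVT_max ab cf.
have [_ ub] : [set m | (derive2_within E f @` E) m /\
    ubound (derive2_within E f @` E) m] (max_derive2 E f).
  apply: getI (derive2_within E f c) _.
  by split; [exists c|move=> _ [t tE <-]; exact: cmax].
by move=> t tE; apply: ub; exists t.
Qed.

End Segment.

Theorem theorem2p13 (R : realType) (a b : R) (f : R -> R)
    (n : nat) (p x : 'I_n -> R) :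
  let E : set R := `[a, b]%classic in
  let m := min_derive2 E f in
  let M := max_derive2 E f in
  let D := f a + f b - 2 * f ((a + b) / 2) in
  let J2 := jensen p x (fun t => t ^+ 2) in
  a < b ->
  C2_within E f ->
  convex_function E f ->
  0 < M ->
  (forall i, E (x i)) ->
  (forall i, 0 < p i) ->
  \sum_(i < n) p i = 1 ->
  m / (m + M) * D + (m * M) / (m + M) * (J2 - (b - a) ^+ 2 / 4)
    <= jensen p x f
  /\
  jensen p x f
    <= M / (m + M) * D + (m * M) / (m + M) * (J2 - (b - a) ^+ 2 / 4).
Proof.
move=> E m M D J2 ab [df ddf cf] cvxf M0 xE p0 p1.
have {}p0 i : 0 <= p i by exact: ltW.
have fd := derivable_within_derivative df.
have de := derivable_within_derivative ddf.
have [[c Ec cm] mP] := min_derive2P (ltW ab) cf.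
have MP := max_derive2P (ltW ab) cf.
have m0 : 0 <= m.
  rewrite /m -cm; exact: convex_derivative2_ge0 ab fd de cvxf _ Ec.
have fm t : E t ->
    0 <= 1 * derive_within E (derive_within E f) t + - (m / 2) * 2.
  by move=> /mP mt; rewrite mulNr subr_ge0 mul1r divfK.
have fM t : E t ->
    0 <= -1 * derive_within E (derive_within E f) t + M / 2 * 2.
  by move=> /MP tM; rewrite mulN1r addrC subr_ge0 divfK.
have lower := above_tangents_comb_sqr fd de fm.
have upper := above_tangents_comb_sqr fd de fM.
have := jensen_ge0 xE p0 p1 lower; have := jensen_le xE p0 p1 ab lower.
have := jensen_ge0 xE p0 p1 upper; have := jensen_le xE p0 p1 ab upper.
rewrite !jensen_comb -/J2.
move: (jensen p x f) => J h4 h3 h2 h1.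
have mM0 : 0 < m + M by rewrite ltr_wpDl.
have h1' : 0 <= M * (J - m / 2 * J2) by rewrite mulr_ge0 ?(ltW M0)//; lra.
have h2' : 0 <= M * (D - m * (b - a) ^+ 2 / 4 - (J - m / 2 * J2)).
  by rewrite mulr_ge0 ?(ltW M0)// subr_ge0 /D; lra.
have h3' : 0 <= m * (M / 2 * J2 - J) by rewrite mulr_ge0//; lra.
have h4' : 0 <= m * (M * (b - a) ^+ 2 / 4 - D - (M / 2 * J2 - J)).
  by rewrite mulr_ge0// subr_ge0 /D; lra.
split.
  rewrite mulrAC [X in _ + X]mulrAC -mulrDl ler_pdivrMr//; lra.
rewrite mulrAC [X in _ + X]mulrAC -mulrDl ler_pdivlMr//; lra.
Qed.
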